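(* Let $p\ge1$ and $\mu\ge1$ be integers, and $\mathbf A,\mathbf B,\mathbf C\in M(p,\mathbb C)$ with $\mathbf A=\mathbf A^\dagger$, $\mathbf C=\mathbf C^\dagger$. Let $g=\begin{bmatrix}a&b\\ \overline b&\overline a\end{bmatrix}\in SU(1,1)$ (so $|a|^2-|b|^2=1$), and put $${}^g\!\mathbf A:=(|a|^2+|b|^2)\mathbf A-2(\overline ab\,\mathbf B+a\overline b\,\mathbf B^\dagger),\qquad {}^g\mathbf B:=-\overline{ab}\,\mathbf A+\overline a^2\mathbf B+\overline b^2\mathbf B^\dagger .$$ (i) A function $f\in\mathcal H_\mu(\mathbf D)\otimes\mathbb C^p$ satisfies $$(\mathbf Bz^2+\mathbf Az+\mathbf B^\dagger)\frac{df}{dz}=\Bigl(-\mu\mathbf Bz-\frac\mu2\mathbf A+\mathbf C\Bigr)f$$ on $\mathbf D$ if and only if $\tilde f:=\tau_\mu^{\mathbf D}(g)f$ satisfies $$({}^g\mathbf Bz^2+{}^g\!\mathbf Az+{}^g\mathbf B^\dagger)\frac{d\tilde f}{dz}=\Bigl(-\mu\,{}^g\mathbf Bz-\frac\mu2{}^g\!\mathbf A+\mathbf C\Bigr)\tilde f$$ on $\mathbf D$. (ii) Suppose moreover that $\det(\mathbf Bz^2+\mathbf Az+\mathbf B^\dagger)\not\equiv0$ and that all poles of $(\mathbf Bz^2+\mathbf Az+\mathbf B^\dagger)^{-1}$ in $\mathbb C$ are of order $1$; let $\alpha_1,\dots,\alpha_N$ be the distinct poles and $\mathbf P_{\alpha_j}$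 the residue at $\alpha_j$; if $\det\mathbf B\neq0$ set $\mathbf P_0:=\mathbf 0$ (if $\det\mathbf B=0$, then $0$ is a pole and $\mathbf P_0$ is the residue there). Then, as rational matrix functions of $z$, $$({}^g\mathbf Bz^2+{}^g\!\mathbf Az+{}^g\mathbf B^\dagger)^{-1}\Bigl(-\mu\,{}^g\mathbf Bz-\frac\mu2{}^g\!\mathbf A+\mathbf C\Bigr)=\sum_{\substack{1\le j\le N\\ g.\alpha_j\ne\infty}}\frac1{z-g.\alpha_j}\mathbf P_{\alpha_j}\Bigl(-\mu\Bigl(\alpha_j\mathbf B+\frac12\mathbf A\Bigr)+\mathbf C\Bigr)-\frac1{z-g.\infty}\mathbf P_0^\dagger\Bigl(\frac\mu2\mathbf A+\mathbf C\Bigr),$$ where the last term is omitted if $b=0$ (i.e. if $g.\infty=\infty$).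
   Context: $\mathbf X^\dagger$ is the conjugate transpose of $\mathbf X$; ${}^g\mathbf B^\dagger$ means $({}^g\mathbf B)^\dagger$. $\mathbf D=\{z\in\mathbb C:|z|<1\}$. $\mathcal H_\mu(\mathbf D)$ is the Hilbert space of holomorphic functions $\sum_{m\ge0}a_mz^m$ on $\mathbf D$ with $\sum_{m\ge0}\frac{m!}{(\mu)_m}|a_m|^2<\infty$, where $(\mu)_m=\mu(\mu+1)\cdots(\mu+m-1)$, $(\mu)_0=1$. The group $SU(1,1)$ acts on $\mathcal H_\mu(\mathbf D)$ (componentwise on $\mathcal H_\mu(\mathbf D)\otimes\mathbb C^p$) by $$\tau_\mu^{\mathbf D}\Bigl(\begin{bmatrix}a&b\\c&d\end{bmatrix}^{-1}\Bigr)f(z)=(cz+d)^{-\mu}f\Bigl(\frac{az+b}{cz+d}\Bigr).$$ $SU(1,1)$ acts on $\mathbb C\cup\{\infty\}$ by $g.\alpha=\frac{a\alpha+b}{\overline b\alpha+\overline a}$ (equal to $\infty$ if $\overline b\alpha+\overline a=0$) and $g.\infty=a/\overline b$ (equal to $\infty$ if $b=0$). *)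

(* Defs.v *)
From mathcomp Require Import all_boot all_order all_algebra.
From mathcomp Require Import complex.
From mathcomp Require Import all_classical all_reals all_analysis.

Set Implicit Arguments.
Unset Strict Implicit.
Unset Printing Implicit Defensive.

Import Order.TTheory GRing.Theory Num.Theory numFieldNormedType.Exports.

Local Open Scope classical_set_scope.
Local Open Scope ring_scope.
Local Open Scope sesquilinear_scope.

(* Typing R[i] as a numClosedFieldType gives it at once the conjugation [z^*]
   and the norm topology that every numFieldType carries over itself. *)
Definition Cplx (R : realType) : numClosedFieldType := R[i].

Definition disc (R : realType) : set (Cplx R) := [set z | `|z| < 1].

Definition pochhammer (mu m : nat) : nat := (\prod_(k < m) (mu + k))%N.

(* Membership in H_mu(D).  An element of H_mu(D) is represented by any total
   function extending it; nothing below depends on the values outside D.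
   [`|a m|] lives in R[i], hence the projection to R. *)
Definition Hmu (R : realType) (mu : nat) : set (Cplx R -> Cplx R) :=
  [set h | (forall z, disc z -> derivable h z 1) /\
    exists a : nat -> Cplx R,
      (forall z, disc z -> series (fun m => a m * z ^+ m) @ \oo --> h z) /\
      (\sum_(0 <= m <oo)
         (m`!%:R / (pochhammer mu m)%:R * (complex.Re `|a m|) ^+ 2)%:E
       < +oo)%E].

(* H_mu(D) (x) C^p, as p-tuples of elements of H_mu(D) *)
Definition Hmu_vec (R : realType) (mu p : nat) :
    set (Cplx R -> 'cV[Cplx R]_p) :=
  [set f | forall i, Hmu mu (fun z => f z i 0)].

Definition su11 (R : realType) (a b : Cplx R) : 'M[Cplx R]_2 :=
  \matrix_(i < 2, j < 2)
    if i == 0 then (if j == 0 then a else b) else (if j == 0 then b^* else a^*).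

(* The formula for tau_mu(h^-1) f has the entries of h in it; here h = g^-1. *)
Definition tau (R : realType) (mu p : nat) (g : 'M[Cplx R]_2)
    (f : Cplx R -> 'cV[Cplx R]_p) : Cplx R -> 'cV[Cplx R]_p :=
  fun z => let h := invmx g in
    (h 1 0 * z + h 1 1) ^- mu
      *: f ((h 0 0 * z + h 0 1) / (h 1 0 * z + h 1 1)).

(* action of [su11 a b] on C u {oo}, with [None] for oo *)
Definition mobius (R : realType) (a b : Cplx R) (x : option (Cplx R)) :
    option (Cplx R) :=
  match x with
  | Some z => if b^* * z + a^* == 0 then None
              else Some ((a * z + b) / (b^* * z + a^*))
  | None => if b == 0 then None else Some (a / b^*)
  end.

Definition gA (R : realType) (p : nat) (a b : Cplx R) (A B : 'M[Cplx R]_p) :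
    'M[Cplx R]_p :=
  (`|a| ^+ 2 + `|b| ^+ 2) *: A
  - 2 *: ((a^* * b) *: B + (a * b^*) *: B^t*).

Definition gB (R : realType) (p : nat) (a b : Cplx R) (A B : 'M[Cplx R]_p) :
    'M[Cplx R]_p :=
  - ((a * b)^* *: A) + (a^*) ^+ 2 *: B + (b^*) ^+ 2 *: B^t*.

(* Over a general field K, so as to be used both at the points x of C and at
   the indeterminate x of C(z).  In [quadmx], D stands for the adjoint of B. *)
Definition quadmx (K : fieldType) (p : nat) (x : K) (B A D : 'M[K]_p) :
    'M[K]_p :=
  x ^+ 2 *: B + x *: A + D.

Definition rhsmx (K : fieldType) (p mu : nat) (x : K) (B A C : 'M[K]_p) :
    'M[K]_p :=
  - ((mu%:R * x) *: B) - (mu%:R / 2) *: A + C.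

Definition solves (R : realType) (p mu : nat) (A B C : 'M[Cplx R]_p)
    (f : Cplx R -> 'cV[Cplx R]_p) : Prop :=
  forall z, disc z ->
    (forall i, derivable (fun w => f w i 0) z 1) /\
    quadmx z B A (B^t*) *m (\col_i derive1 (fun w => f w i 0) z)
      = rhsmx mu z B A C *m f z.

(* rational functions of one complex variable *)
Definition ratfun (R : realType) : fieldType := {fraction {poly Cplx R}}.

Definition ratX (R : realType) : ratfun R := tofrac ('X : {poly Cplx R}).

Definition ratC (R : realType) (c : Cplx R) : ratfun R := tofrac c%:P.

Definition ratmx (R : realType) (p : nat) (M : 'M[Cplx R]_p) :
    'M[ratfun R]_p :=
  map_mx (@ratC R) M.

Definition ratquad (R : realType) (p : nat) (A B : 'M[Cplx R]_p) :
    'M[ratfun R]_p :=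
  quadmx (ratX R) (ratmx B) (ratmx A) (ratmx (B^t*)).

Definition ratrhs (R : realType) (p mu : nat) (A B C : 'M[Cplx R]_p) :
    'M[ratfun R]_p :=
  rhsmx mu (ratX R) (ratmx B) (ratmx A) (ratmx C).

Definition regular_at (R : realType) (p : nat) (F : 'M[ratfun R]_p)
    (c : Cplx R) : Prop :=
  forall i j, exists n d : {poly Cplx R},
    d.[c] != 0 /\ F i j = tofrac n / tofrac d.

Definition is_pole (R : realType) (p : nat) (F : 'M[ratfun R]_p)
    (c : Cplx R) : Prop :=
  ~ regular_at F c.

Definition pole_of_order (R : realType) (p : nat) (F : 'M[ratfun R]_p)
    (c : Cplx R) (m : nat) : Prop :=
  [/\ (0 < m)%N,
      regular_at ((ratX R - ratC c) ^+ m *: F) c &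
      ~ regular_at ((ratX R - ratC c) ^+ m.-1 *: F) c].

(* P is the coefficient of (z - c)^-1 in the Laurent expansion of F at c; the
   matrices L 0, ..., L k are the coefficients of the principal part. *)
Definition is_residue (R : realType) (p : nat) (F : 'M[ratfun R]_p)
    (c : Cplx R) (P : 'M[Cplx R]_p) : Prop :=
  exists (k : nat) (L : nat -> 'M[Cplx R]_p),
    L 0%N = P /\
    regular_at
      (F - \sum_(j < k.+1) (ratX R - ratC c) ^- j.+1 *: ratmx (L j)) c.

(* 1 / (z - x), equal to 0 for x = oo: terms with pole at oo drop out *)
Definition simple_frac (R : realType) (x : option (Cplx R)) : ratfun R :=
  if x is Some c then (ratX R - ratC c)^-1 else 0.

(* Main.v *)
Require Import Defs.
From HB Require Import structures.
From mathcomp Require Import all_boot all_order all_algebra.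
From mathcomp Require Import complex.
From mathcomp Require Import all_classical all_reals all_analysis.
From mathcomp Require Import ring.

Set Implicit Arguments.
Unset Strict Implicit.
Unset Printing Implicit Defensive.

Import Order.TTheory GRing.Theory Num.Theory numFieldNormedType.Exports.

Local Open Scope classical_set_scope.
Local Open Scope ring_scope.
Local Open Scope sesquilinear_scope.

(** Put Q(z) = B z^2 + A z + B^dagger and let y be the Moebius map of g^-1, with
denominator d.  Then gQ(z) = d^2 Q(y), and the right-hand side for g at z is
mu conj(b) d Q(y) plus the old one at y; together with y' = d^-2 this gives (i).

For (ii), the symmetry Q(z)^dagger = conj(z)^2 Q(1/conj(z)) transports the
behaviour of F = Q^-1 at 0 to infinity: F(z) = P0^dagger/z + O(z^-2).  Hence F
has no polynomial part, F = sum_j P_j/(z - alpha_j), and sum_j P_j = P0^dagger.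
Comparing polar parts and coefficients in F Q = 1 gives P_j Q(alpha_j) = 0,
P0^dagger B = 0 and sum_j alpha_j P_j B + P0^dagger A = 1.  By these identities
sum_j P_j/(y - alpha_j) inverts Q(y) at any point y of an extension field, and
the rest is
d^-2/(y - alpha) = 1/(z - g.alpha) - 1/(z - g.oo). *)

(** * Extending morphisms to fraction fields *)

Section FractionLift.
Variables (D : idomainType) (K : fieldType) (f : {rmorphism D -> K}).
Hypothesis f_inj : injective f.
Local Open Scope quotient_scope.
Local Notation tofrac := (@FracField.tofrac D).
Local Notation numer x := (frac x).1.
Local Notation denom x := (frac x).2.

Lemma fractionE (x : {fraction D}) :
  x = tofrac (numer (repr x)) / tofrac (denom (repr x)).
Proof.
have dN0 := @denom_ratioP D.
apply: (@mulIf _ (tofrac (denom (repr x)))); first by rewrite tofrac_eq0.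
rewrite mulfVK ?tofrac_eq0 //.
move: (reprK x); set r := repr x => <-.
(* Both sides become classes of ratios, which [FracField.equivfE] compares by
   cross-multiplication. *)
rewrite /FracField.tofrac; unlock; rewrite -[LHS]FracField.pi_mul.
apply/eqmodP; rewrite /= FracField.equivfE /FracField.mulf.
by rewrite !numden_Ratio ?mulf_neq0 ?oner_eq0 // mulr1 mulr1 mulrC.
Qed.

(** Uses the chosen representative; for injective [f], images of denominators are nonzero and
    [frac_liftE] gives independence of the choice. *)
Definition frac_lift (x : {fraction D}) : K :=
  f (numer (repr x)) / f (denom (repr x)).

Lemma frac_liftE n d : d != 0 -> frac_lift (tofrac n / tofrac d) = f n / f d.
Proof.
move=> dN0; rewrite /frac_lift; set x : {fraction D} := tofrac n / _.
have := fractionE x; rewrite {1}/x.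
set n' := numer _; set d' := denom _ => /eqP.
have d'N0 : d' != 0 by exact: denom_ratioP.
have fN0 e : e != 0 -> f e != 0.
  by move=> eN0; rewrite -(rmorph0 f) (inj_eq f_inj).
rewrite eqr_div ?tofrac_eq0 // -!tofracM tofrac_eq => /eqP e.
by apply/eqP; rewrite eqr_div ?fN0 // -!rmorphM e.
Qed.

End FractionLift.

(** * Regular rational functions and principal parts *)

Section Regular.
Variable C : fieldType.
Local Notation K := {fraction {poly C}}.
Local Notation tofrac := (@FracField.tofrac {poly C}).
Local Notation X := (tofrac 'X).
Local Notation ratC l := (tofrac l%:P).
Implicit Types (c l : C) (x y : K).

(** The scalar form of [regular_at], which unfolds to [reg] at every entry of a matrix. *)
Definition reg c x :=
  exists n d : {poly C}, d.[c] != 0 /\ x = tofrac n / tofrac d.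

Lemma reg_poly c (n : {poly C}) : reg c (tofrac n).
Proof. by exists n, 1; rewrite hornerC oner_eq0 tofrac1 divr1. Qed.

Lemma reg_inv c (d : {poly C}) : d.[c] != 0 -> reg c (tofrac d)^-1.
Proof. by move=> dc; exists 1, d; rewrite tofrac1 div1r. Qed.

Lemma horner_neq0 c (d : {poly C}) : d.[c] != 0 -> tofrac d != 0.
Proof. by rewrite tofrac_eq0; apply: contraNneq => ->; rewrite horner0. Qed.

Lemma regD c x y : reg c x -> reg c y -> reg c (x + y).
Proof.
move=> [n [d [dc ->]]] [m [e [ec ->]]].
have dN0 := horner_neq0 dc; have eN0 := horner_neq0 ec.
exists (n * e + m * d), (d * e); rewrite hornerM mulf_neq0 //.
by split => //; rewrite tofracD !tofracM (addf_div _ _ dN0 eN0).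
Qed.

Lemma regM c x y : reg c x -> reg c y -> reg c (x * y).
Proof.
move=> [n [d [dc ->]]] [m [e [ec ->]]].
exists (n * m), (d * e); rewrite hornerM mulf_neq0 //.
by rewrite !tofracM mulf_div.
Qed.

Lemma regC c l : reg c (ratC l).
Proof. exact: reg_poly. Qed.

Lemma regN c x : reg c x -> reg c (- x).
Proof.
by move=> [n [d [dc ->]]]; exists (- n), d; split => //; rewrite tofracN mulNr.
Qed.

Lemma regB c x y : reg c x -> reg c y -> reg c (x - y).
Proof. by move=> rx /regN; exact: regD. Qed.

Lemma reg_sum c (I : Type) (r : seq I) (P : pred I) (F : I -> K) :
  (forall i, P i -> reg c (F i)) -> reg c (\sum_(i <- r | P i) F i).
Proof.
move=> rF; apply: (big_ind (reg c)) => //; last exact: regD.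
by rewrite -tofrac0; exact: reg_poly.
Qed.

Lemma ratXBC c : X - ratC c = tofrac ('X - c%:P).
Proof. by rewrite tofracB. Qed.

Lemma ratXBC_neq0 c : X - ratC c != 0.
Proof. by rewrite ratXBC tofrac_eq0 polyXsubC_eq0. Qed.

Lemma reg_XBC c d : reg c (X - ratC d).
Proof. by rewrite ratXBC; exact: reg_poly. Qed.

Lemma reg_XBCV c d : c != d -> reg c (X - ratC d)^-1.
Proof.
by move=> cd; rewrite ratXBC; apply: reg_inv; rewrite hornerXsubC subr_eq0.
Qed.

Lemma regX c x k : reg c x -> reg c (x ^+ k).
Proof.
move=> rx; elim: k => [|k IH]; last by rewrite exprS; exact: regM.
by rewrite expr0 -tofrac1; exact: reg_poly.
Qed.

(** Clear denominators and evaluate at [c]: the factor [X - c] kills one side and leaves [l * d.[c]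
    = 0] on the other. *)
Lemma reg_simple_pole c l : reg c (ratC l / (X - ratC c)) -> l = 0.
Proof.
move=> [n [d [dc /eqP]]].
have dN0 := horner_neq0 dc; have TN0 := ratXBC_neq0 c.
rewrite (eqr_div _ _ TN0 dN0) ratXBC -!tofracM tofrac_eq => /eqP.
move=> /(congr1 (horner^~ c)) /eqP.
by rewrite !hornerM hornerC hornerXsubC subrr mulr0 mulf_eq0 (negPf dc) orbF
  => /eqP.
Qed.

(** Uniqueness of principal parts. Multiplying by the power of [X - c] one below the highest leaves
    the top coefficient over [X - c] plus regular terms, so that coefficient vanishes; induction
    removes the rest. *)
Lemma reg_principal_part c n (l : nat -> C) :
  reg c (\sum_(j < n) ratC (l j) * (X - ratC c) ^- j.+1) ->
  forall j, (j < n)%N -> l j = 0.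
Proof.
have TN0 := ratXBC_neq0 c; have rT := reg_XBC c c.
move: (X - ratC c) TN0 rT (@reg_simple_pole c) => T TN0 rT rsp.
elim: n => // n IH rl.
have TnN0 k : T ^+ k != 0 by exact: expf_neq0.
have ln : l n = 0.
  apply: rsp.
  have -> : ratC (l n) / T = T ^+ n * (ratC (l n) / T ^+ n.+1).
    by rewrite mulrCA exprS invfM [T^-1 * _]mulrC (mulVKf (TnN0 n)).
  have -> : T ^+ n * (ratC (l n) / T ^+ n.+1) =
      T ^+ n * (\sum_(j < n.+1) ratC (l j) / T ^+ j.+1)
      - \sum_(j < n) ratC (l j) * T ^+ (n - j.+1).
    rewrite big_ord_recr /= mulrDr addrAC mulr_sumr -sumrB.
    rewrite big1 ?add0r // => j _.
    rewrite -{1}(subnK (ltn_ord j)) exprD mulrCA (mulfK (TnN0 j.+1)).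
    by rewrite subrr.
  apply: regB; first by apply: regM rl; exact: regX.
  by apply: reg_sum => j _; apply: regM; [exact: regC|exact: regX].
move=> j; rewrite ltnS leq_eqVlt => /predU1P[->//|]; apply: IH.
by move: rl; rewrite big_ord_recr /= ln polyC0 tofrac0 mul0r addr0.
Qed.

(* [l] is the value of (X - c) x at [c]. *)
Lemma reg_split c x : reg c ((X - ratC c) * x) ->
  exists l, reg c (x - ratC l / (X - ratC c)).
Proof.
have TN0 := ratXBC_neq0 c.
move=> [n [d [dc e]]]; exists (n.[c] / d.[c]).
have dN0 := horner_neq0 dc.
have : root (n - (n.[c] / d.[c]) *: d) c.
  by rewrite /root !hornerE mulfVK ?subrr.
move=> /factor_theorem[q qE]; exists q, d; split => //.
apply: (mulIf TN0); apply: (mulIf dN0).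
rewrite mulrBl (mulfVK TN0) [x * _]mulrC e mulrBl (mulfVK dN0).
rewrite [_ / _ * _ * tofrac d]mulrAC (mulfVK dN0).
by rewrite ratXBC -[RHS]tofracM -qE tofracB -mul_polyC tofracM.
Qed.

End Regular.

(** Choose a representation whose denominator has least size. If it is not constant it has a root;
    regularity there makes the numerator vanish too, and cancelling the common factor contradicts
    minimality. *)
Lemma reg_everywhere_poly (C : closedFieldType) (x : {fraction {poly C}}) :
  (forall c, reg c x) -> exists h, x = FracField.tofrac h.
Proof.
move=> rx; pose P k := exists n d : {poly C},
  [/\ d != 0, size d = k & x = FracField.tofrac n / FracField.tofrac d].
have : exists k, `[<P k>].
  have [n [d [dc e]]] := rx 0; exists (size d); apply/asboolP; exists n, d.
  by split => //; rewrite -tofrac_eq0 (horner_neq0 dc).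
move=> /ex_minnP[m /asboolP[n [d [dN0 sd e]]] mP].
have FN0 (u : {poly C}) : u != 0 -> FracField.tofrac u != 0.
  by rewrite tofrac_eq0.
have [d1|d1] := boolP (size d == 1%N).
  move: d1 => /size_poly1P[u uN0 du].
  have uN0' := FN0 _ dN0.
  exists (u^-1 *: n); rewrite e -mul_polyC tofracM mulrC; congr (_ * _).
  by apply: (mulIf uN0'); rewrite (mulVf uN0') -tofracM du -polyCM mulVf.
have [c rdc] := closed_rootP d d1.
have [n' [d' [d'c e']]] := rx c.
(* Cross-multiply with a representation whose denominator does not vanish at [c]; evaluation at [c]
   then forces [n.[c] = 0]. *)
have dd : n * d' = n' * d.
  apply/eqP; rewrite -tofrac_eq !tofracM.
  by rewrite -(eqr_div _ _ (FN0 _ dN0) (horner_neq0 d'c)) -e -e'.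
have rnc : root n c.
  have := congr1 (horner^~ c) dd; rewrite !hornerM (rootP rdc) mulr0.
  by move=> /eqP; rewrite mulf_eq0 (negPf d'c) orbF.
move: rnc rdc => /factor_theorem[n1 n1E] /factor_theorem[d1' d1E].
have d1N0 : d1' != 0 by apply: contraNneq dN0; rewrite d1E => ->; rewrite mul0r.
have TN0 : FracField.tofrac ('X - c%:P) != 0 by rewrite FN0 ?polyXsubC_eq0.
have : `[<P (size d1')>].
  apply/asboolP; exists n1, d1'; split => //.
  by rewrite e n1E d1E !tofracM -mulf_div (divff TN0) mulr1.
move=> /mP; rewrite -sd d1E size_Mmonic ?monicXsubC // size_XsubC addn2 /=.
by rewrite ltnn.
Qed.

(** * The lift to the fraction field as a ring morphism *)

Section FractionMorphism.
Variables (D : idomainType) (K : fieldType) (f : {rmorphism D -> K}).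
Hypothesis f_inj : injective f.
Local Notation tofrac := (@FracField.tofrac D).

Lemma frac_lift_tofrac n : frac_lift f (tofrac n) = f n.
Proof.
have := frac_liftE f_inj n (oner_neq0 D).
by rewrite tofrac1 divr1 rmorph1 divr1.
Qed.

Lemma fraction_neq0P (x : {fraction D}) :
  exists n d : D,
    [/\ d != 0, tofrac d != 0, f d != 0 & x = tofrac n / tofrac d].
Proof.
exists (frac (repr x)).1, (frac (repr x)).2.
have dN0 : (frac (repr x)).2 != 0 by exact: denom_ratioP.
rewrite -(rmorph0 f) (inj_eq f_inj) tofrac_eq0 dN0; split=> //.
exact: fractionE.
Qed.

Lemma frac_liftD : {morph frac_lift f : x y / x + y}.
Proof.
move=> x y.
have [n [d [dN0 tdN0 fdN0 ->]]] := fraction_neq0P x.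
have [m [e [eN0 teN0 feN0 ->]]] := fraction_neq0P y.
rewrite (addf_div _ _ tdN0 teN0) -!tofracM -tofracD.
rewrite !(frac_liftE f_inj) ?mulf_neq0 //.
by rewrite (addf_div _ _ fdN0 feN0) rmorphD !rmorphM.
Qed.

Lemma frac_liftM : {morph frac_lift f : x y / x * y}.
Proof.
move=> x y.
have [n [d [dN0 tdN0 fdN0 ->]]] := fraction_neq0P x.
have [m [e [eN0 teN0 feN0 ->]]] := fraction_neq0P y.
rewrite mulf_div -!tofracM.
by rewrite !(frac_liftE f_inj) ?mulf_neq0 // mulf_div !rmorphM.
Qed.

Lemma frac_lift_is_zmod_morphism : zmod_morphism (frac_lift f).
Proof.
move=> x y; apply: (addIr (frac_lift f y)).
by rewrite -frac_liftD !subrK.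
Qed.

Lemma frac_lift_is_monoid_morphism : monoid_morphism (frac_lift f).
Proof.
split; last exact: frac_liftM.
by rewrite -tofrac1 frac_lift_tofrac rmorph1.
Qed.
End FractionMorphism.

(** * The inverse of the quadratic pencil *)

Section Reflection.
Variable C : numClosedFieldType.
Local Notation K := {fraction {poly C}}.
Local Notation tofrac := (@FracField.tofrac {poly C}).
Local Notation X := (tofrac 'X).
Local Notation ratC := (tofrac \o polyC).

Lemma reflect_comm : commr_rmorph (ratC \o (@Num.conj C)) X^-1.
Proof. by move=> x; exact: mulrC. Qed.

Definition reflect_poly : {poly C} -> K := horner_morph reflect_comm.
HB.instance Definition _ := GRing.RMorphism.on reflect_poly.

Lemma reflect_polyE (q : {poly C}) :
  reflect_poly q = \sum_(k < size q) ratC (q`_k)^* * X ^- k.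
Proof.
rewrite /reflect_poly /horner_morph /map_poly horner_poly.
by apply: eq_bigr => k _; rewrite exprVn.
Qed.

Lemma ratX_neq0 : X != 0.
Proof. by rewrite tofrac_eq0 polyX_eq0. Qed.

(** Makes [frac_lift] applicable. The conjugated coefficients of [q] form the principal part at 0 of
    [X^-1 * reflect_poly q]; the extra [X^-1] is there because principal parts start at exponent
    -1. *)
Lemma reflect_poly_inj : injective reflect_poly.
Proof.
have XN0 := ratX_neq0.
move=> q r qr; apply/eqP; rewrite -subr_eq0; apply/eqP.
have {qr} : reflect_poly (q - r) = 0 by rewrite rmorphB /= qr subrr.
move: (q - r) => {r}q q0; apply/polyP => k; rewrite coef0.
have [kq|kq] := ltnP k (size q); last by rewrite nth_default.
have : reg 0 (\sum_(j < size q) tofrac (q`_j)^*%:P * (X - tofrac 0%:P) ^- j.+1).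
  rewrite polyC0 tofrac0 subr0.
  have -> : \sum_(j < size q) tofrac (q`_j)^*%:P * X ^- j.+1
      = X^-1 * reflect_poly q.
    rewrite reflect_polyE mulr_sumr; apply: eq_bigr => j _.
    by rewrite exprS invfM [LHS]mulrCA.
  by rewrite q0 mulr0 -tofrac0; exact: reg_poly.
move=> /(@reg_principal_part _ _ _ (fun j => (q`_j)^*)) /(_ _ kq) /eqP.
by rewrite conjC_eq0 => /eqP.
Qed.

(* The map h |-> (z |-> conj (h (1 / conj z))) on rational functions. *)
Definition reflect : K -> K := frac_lift reflect_poly.
HB.instance Definition _ := GRing.isZmodMorphism.Build K K reflect
  (frac_lift_is_zmod_morphism reflect_poly_inj).
HB.instance Definition _ := GRing.isMonoidMorphism.Build K K reflect
  (frac_lift_is_monoid_morphism reflect_poly_inj).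

Lemma reflectX : reflect X = X^-1.
Proof.
rewrite /reflect (frac_lift_tofrac reflect_poly_inj); exact: horner_morphX.
Qed.

Lemma reflectC c : reflect (ratC c) = ratC c^*.
Proof.
rewrite /reflect (frac_lift_tofrac reflect_poly_inj); exact: horner_morphC.
Qed.
Lemma reflect_tofrac (q : {poly C}) :
  reflect (tofrac q) = \sum_(k < size q) ratC (q`_k)^* * X ^- k.
Proof.
rewrite /reflect (frac_lift_tofrac reflect_poly_inj); exact: reflect_polyE.
Qed.
End Reflection.

Lemma quad_reverse (F : fieldType) (x u v w : F) : x != 0 ->
  x^-1 / x * w + x^-1 * v + u = (x * x)^-1 * (x * x * u + x * v + w).
Proof. by move=> xN0; field. Qed.

(** Reflection of a simple polar term: its residue reappears as a residue at 0, next to a term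
    regular at 0. *)
Lemma polar_reflect (F : fieldType) (x u v : F) : x != 0 -> 1 - v * x != 0 ->
  x ^- 2 * (u / (x^-1 - v)) = u / x + u * v / (1 - v * x).
Proof.
move=> xN0 dN0.
have -> : x^-1 - v = (1 - v * x) / x by rewrite mulrBl mul1r mulfK.
by field; rewrite xN0 dN0.
Qed.

Section Resolvent.
Variables (C : numClosedFieldType) (p : nat) (A B : 'M[C]_p).
Hypothesis hA : A = A^t*.
Local Notation K := {fraction {poly C}}.
Local Notation tofrac := (@FracField.tofrac {poly C}).
Local Notation X := (tofrac 'X).
Local Notation ratC := (tofrac \o polyC).
Local Notation ratmx := (map_mx ratC).
(** The pencil [ratquad], over an arbitrary [numClosedFieldType]. *)
Definition fracquad : 'M[K]_p := quadmx X (ratmx B) (ratmx A) (ratmx (B^t*)).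
Local Notation Q := fracquad.

(** Reflection reverses the order of the coefficients; the adjoint exchanges B with its adjoint and
    fixes the Hermitian A, which restores the order. *)
Lemma reflect_fracquad : (map_mx (@reflect C) Q)^T = X ^- 2 *: Q.
Proof.
have XN0 : X != 0 := ratX_neq0 C.
have hA' i j : (A j i)^* = A i j by rewrite [in RHS]hA !mxE.
apply/matrixP => i j; rewrite !mxE.
have -> : X ^+ 2 = X * X by [].
rewrite !rmorphD !rmorphM /= reflectX !reflectC conjCK hA'.
exact: quad_reverse.
Qed.
Hypothesis detQ : \det Q != 0.
Local Notation F := (invmx Q).

Lemma fracquad_unit : Q \in unitmx.
Proof. by rewrite unitmxE unitfE. Qed.

(** Reflect and transpose [F Q = 1], then cancel [Q]. This ties the expansion of [F] at infinity to
    the one at 0. *)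
Lemma invmx_fracquad_reflect i k : F i k = X ^- 2 * reflect (F k i).
Proof.
have /(congr1 (fun M => (map_mx (@reflect C) M)^T)) := mulVmx fracquad_unit.
rewrite map_mxM map_mx1 trmx_mul trmx1 reflect_fracquad -scalemxAl scalemxAr.
move=> /(congr1 (mulmx F)); rewrite (mulKmx fracquad_unit) mulmx1.
by move=> /matrixP /(_ i k); rewrite !mxE.
Qed.

Variables (N : nat) (alpha : 'I_N -> C) (P : 'I_N -> 'M[C]_p) (P0 : 'M[C]_p).
Hypothesis alpha_inj : injective alpha.
Hypothesis regF :
  forall c, (forall j, alpha j <> c) -> forall i k, reg c (F i k).
Hypothesis regFP : forall j i k,
  reg (alpha j) (F i k - ratC (P j i k) / (X - ratC (alpha j))).
Hypothesis regF0 : forall i k, reg 0 (F i k - ratC (P0 i k) / X).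

(** Subtracting all polar parts leaves a function regular at every point, hence a polynomial. *)
Lemma invmx_fracquad_polar i k : exists h : {poly C},
  F i k = tofrac h + \sum_j ratC (P j i k) / (X - ratC (alpha j)).
Proof.
suff /reg_everywhere_poly[h hE] : forall c,
    reg c (F i k - \sum_j ratC (P j i k) / (X - ratC (alpha j))).
  by exists h; rewrite -hE subrK.
have regV j c : alpha j != c -> reg c (ratC (P j i k) / (X - ratC (alpha j))).
  by move=> jc; apply: regM; [exact: regC|apply: reg_XBCV; rewrite eq_sym].
move=> c; have [[j jc]|nc] := pselect (exists j, alpha j = c).
  rewrite (bigD1 j) //= opprD addrA; apply: regB; first by rewrite -jc.
  apply: reg_sum => m mj; apply: regV.
  by rewrite -jc (inj_eq alpha_inj).
apply: regB; first by apply: regF => j jc; apply: nc; exists j.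
by apply: reg_sum => j _; apply: regV; apply/eqP => jc; apply: nc; exists j.
Qed.

Lemma invmx_fracquad_strictly_proper i k :
  F i k = \sum_j ratC (P j i k) / (X - ratC (alpha j))
  /\ \sum_j (P j i k) = (P0 k i)^*.
Proof.
have XN0 : X != 0 := ratX_neq0 C.
have [h hE] := invmx_fracquad_polar i k.
(* The principal part at 0 of the reflected entry minus its polar term: [l 0] is the excess in the
   residue, and coefficient [m'] of [h] lands at exponent -(m'+2), which is index [m'.+1]. *)
pose l m := if m is m'.+1 then (h`_m')^* else \sum_j (P j i k)^* - P0 k i.
pose rest :=
  \sum_j ratC ((P j i k)^* * (alpha j)^*) / (1 - ratC (alpha j)^* * X).
have denE j : 1 - ratC (alpha j)^* * X = tofrac (1 - (alpha j)^* *: 'X).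
  by rewrite tofracB tofrac1 -mul_polyC tofracM.
have den0 j : (1 - (alpha j)^* *: 'X).[0] != 0.
  by rewrite hornerD hornerN hornerZ hornerX hornerC mulr0 subr0 oner_neq0.
have den_neq0 j : 1 - ratC (alpha j)^* * X != 0.
  by rewrite denE (horner_neq0 (den0 j)).
(* The coefficients of [h] become coefficients of X^-2, X^-3, ... after the
   reflection, so regularity at 0 kills them. *)
have polar : F k i - ratC (P0 k i) / X - rest =
    \sum_(m < (size h).+1) ratC (l m) * (X - tofrac 0%:P) ^- m.+1.
  rewrite polyC0 tofrac0 subr0 big_ord_recl /= expr1.
  have -> : F k i = X ^- 2 * reflect (tofrac h)
      + \sum_j ratC (P j i k)^* / X + rest.
    rewrite invmx_fracquad_reflect hE rmorphD mulrDr -addrA; congr (_ + _).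
    rewrite rmorph_sum mulr_sumr -big_split; apply: eq_bigr => j _ /=.
    rewrite rmorphM fmorphV rmorphB /= reflectX !reflectC /=.
    rewrite polyCM tofracM; exact: (polar_reflect _ XN0 (den_neq0 j)).
  have -> : X ^- 2 * reflect (tofrac h) =
      \sum_(m < size h) ratC (l m.+1) * X ^- m.+2.
    rewrite reflect_tofrac mulr_sumr; apply: eq_bigr => m _ /=.
    by rewrite mulrCA; congr (_ * _); rewrite -invfM -exprD addnC addn2.
  rewrite addrAC addrK -addrA addrC; congr (_ + _).
  by rewrite -mulr_suml -mulrBl -rmorph_sum -rmorphB.
have regrest : reg 0 rest.
  apply: reg_sum => j _; apply: regM; first exact: regC.
  by rewrite denE; exact: reg_inv.
have : reg 0 (\sum_(m < (size h).+1) ratC (l m) * (X - tofrac 0%:P) ^- m.+1).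
  by rewrite -polar; apply: regB.
move=> /reg_principal_part lE; split.
  suff h0 : h = 0 by rewrite hE h0 tofrac0 add0r.
  apply/polyP => m; rewrite coef0; have [mh|mh] := ltnP m (size h).
    by apply/eqP; rewrite -conjC_eq0; apply/eqP; exact: (lE m.+1).
  by rewrite nth_default.
have /eqP := lE 0%N (ltn0Sn _); rewrite /= subr_eq0 => /eqP <-.
by rewrite rmorph_sum; apply: eq_bigr => j _; exact/esym/conjCK.
Qed.
End Resolvent.

(** * Moebius covariance *)

(** Entrywise form of gQ(z) = d^2 Q(y), with primes for conjugates and [u], [v], [w] for entries of
    B, A and the adjoint of B, all taken as independent variables. *)
Lemma scalar_quad_mobius (F : fieldType) (a b a' b' x u v w : F) :
  let d := - b' * x + a in let y := (a' * x + - b) / d in d != 0 ->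
  x ^+ 2 * (- (a' * b' * v) + a' ^+ 2 * u + b' ^+ 2 * w)
  + x * ((a * a' + b * b') * v - 2 * (a' * b * u + a * b' * w))
  + (- (a * b * v) + a ^+ 2 * w + b ^+ 2 * u)
  = d ^+ 2 * (y ^+ 2 * u + y * v + w).
Proof. by move=> d y dN0; rewrite /y; move: dN0; rewrite /d => dN0; field. Qed.

Lemma scalar_rhs_mobius (F : fieldType) (a b a' b' x u v w m : F) :
  let d := - b' * x + a in let y := (a' * x + - b) / d in
  d != 0 -> 2 != 0 :> F -> a * a' - b * b' = 1 ->
  - (m * x * (- (a' * b' * v) + a' ^+ 2 * u + b' ^+ 2 * w))
  - m / 2 * ((a * a' + b * b') * v - 2 * (a' * b * u + a * b' * w))
  = m * b' * d * (y ^+ 2 * u + y * v + w) - m * y * u - m / 2 * v.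
Proof.
move=> d y dN0 twoN0 det1.
(* The two sides differ by this multiple of the determinant relation; being zero, it is added before
   calling [field]. *)
have e : m * (u * y + v / 2) * (a * a' - b * b' - 1) = 0.
  by rewrite det1 subrr mulr0.
rewrite -[LHS]addr0 -e /y; move: dN0; rewrite /d => dN0; field.
by rewrite twoN0 dN0.
Qed.

Section Covariance.
Variables (K : fieldType) (p mu : nat) (a b a' b' x : K) (B A D C : 'M[K]_p).
(** Here [a'] and [b'] stand for conjugates, [D] for the adjoint of [B] and [gD] for that of [gB];
    without conjugation the formulas serve both at points of the disc and at the indeterminate. *)
Let gA := (a * a' + b * b') *: A - 2 *: ((a' * b) *: B + (a * b') *: D).
Let gB := - ((a' * b') *: A) + a' ^+ 2 *: B + b' ^+ 2 *: D.
Let gD := - ((a * b) *: A) + a ^+ 2 *: D + b ^+ 2 *: B.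
Let d := - b' * x + a.
Let y := (a' * x + - b) / d.

Lemma quadmx_mobius : d != 0 -> quadmx x gB gA gD = d ^+ 2 *: quadmx y B A D.
Proof.
move=> dN0; apply/matrixP => i j; rewrite /quadmx /gA /gB /gD !mxE.
exact: scalar_quad_mobius.
Qed.

Lemma rhsmx_mobius : d != 0 -> 2 != 0 :> K -> a * a' - b * b' = 1 ->
  rhsmx mu x gB gA C = (mu%:R * b' * d) *: quadmx y B A D + rhsmx mu y B A C.
Proof.
move=> dN0 twoN0 det1; apply/matrixP => i j.
rewrite /quadmx /rhsmx /gA /gB !mxE [RHS]addrA.
congr (_ + _); rewrite [RHS]addrA.
exact: scalar_rhs_mobius.
Qed.
End Covariance.

(** * Partial fractions evaluated at a point of an extension field *)

Section PartialFractions.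
Variables (F K : fieldType) (f : {rmorphism F -> K}) (p N : nat).
Variables (alpha : 'I_N -> F) (P : 'I_N -> 'M[F]_p) (B A D C : 'M[F]_p).
Variable x : K.
Hypothesis xN : forall j, x - f (alpha j) != 0.
Local Notation fmx := (map_mx f).
Let G := \sum_j (x - f (alpha j))^-1 *: fmx (P j).

(** Divide the pencil by [x - alpha j]: Q(x) = Q(alpha) + (x - alpha)((x + alpha) B + A). The
    remainder gives the polar part, the quotient the polynomial part. *)
Lemma partial_fractions_quad :
  G *m quadmx x (fmx B) (fmx A) (fmx D)
  = \sum_j (x - f (alpha j))^-1 *: fmx (P j *m quadmx (alpha j) B A D)
    + (x *: fmx ((\sum_j P j) *m B)
       + fmx (\sum_j alpha j *: (P j *m B) + (\sum_j P j) *m A)).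
Proof.
have fsum (M : 'I_N -> 'M[F]_p) : fmx (\sum_j M j) = \sum_j fmx (M j).
  exact: raddf_sum.
rewrite map_mxD !mulmx_suml !fsum scaler_sumr.
rewrite -!big_split; apply: eq_bigr => j _ /=.
have -> : quadmx x (fmx B) (fmx A) (fmx D) = fmx (quadmx (alpha j) B A D)
    + (x - f (alpha j)) *: ((x + f (alpha j)) *: fmx B + fmx A).
  rewrite /quadmx !map_mxD !map_mxZ rmorphXn; apply/matrixP => i k.
  by rewrite !mxE; ring.
rewrite mulmxDr -!scalemxAl -scalemxAr scalerA mulVf ?xN // scale1r.
rewrite [fmx (P j *m quadmx _ _ _ _)]map_mxM; congr (_ + _).
by rewrite mulmxDr -scalemxAr scalerDl -addrA map_mxZ !map_mxM.
Qed.

(** The same division for an affine expression, whose quotient is the constant [- mu B]. *)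
Lemma partial_fractions_rhs (mu : nat) :
  G *m rhsmx mu x (fmx B) (fmx A) (fmx C)
  = \sum_j (x - f (alpha j))^-1 *: fmx (P j *m rhsmx mu (alpha j) B A C)
    - mu%:R *: fmx ((\sum_j P j) *m B).
Proof.
have fsum (M : 'I_N -> 'M[F]_p) : fmx (\sum_j M j) = \sum_j fmx (M j).
  exact: raddf_sum.
rewrite !mulmx_suml fsum scaler_sumr -sumrB; apply: eq_bigr => j _ /=.
have -> : rhsmx mu x (fmx B) (fmx A) (fmx C) = fmx (rhsmx mu (alpha j) B A C)
    - (x - f (alpha j)) *: (mu%:R *: fmx B).
  rewrite /rhsmx map_mxD map_mxB map_mxN !map_mxZ rmorphM fmorph_div.
  rewrite !rmorph_nat; apply/matrixP => i k.
  by rewrite !mxE; ring.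
rewrite mulmxBr -!scalemxAl -scalemxAr scalerA mulVf ?xN // scale1r.
by rewrite !map_mxM -scalemxAr.
Qed.
End PartialFractions.

(** Uniqueness of the decomposition: solving for the term at [alpha j] shows it regular there, hence
    zero; the polynomial identity left over is compared coefficient by coefficient. *)
Lemma partial_fractions_coef (C : fieldType) (p N : nat) (alpha : 'I_N -> C)
    (M : 'I_N -> 'M[C]_p) (U V : 'M[C]_p) :
  let X : {fraction {poly C}} := FracField.tofrac 'X in
  let ratC := @FracField.tofrac {poly C} \o polyC in
  injective alpha ->
  \sum_j (X - ratC (alpha j))^-1 *: map_mx ratC (M j)
    + (X *: map_mx ratC U + map_mx ratC V) = 1%:M ->
  [/\ forall j, M j = 0, U = 0 & V = 1%:M].
Proof.
move=> X ratC alpha_inj e.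
have eik i k : \sum_j ratC (M j i k) / (X - ratC (alpha j))
    + FracField.tofrac (U i k *: 'X + (V i k)%:P) =
    FracField.tofrac ((1%:M : 'M[C]_p) i k)%:P.
  have := congr1 (fun Z : (matrix _ p p) => Z i k) e; rewrite !mxE summxE.
  under eq_bigr do rewrite !mxE mulrC.
  move=> e'; transitivity ((i == k)%:R : {fraction {poly C}}).
    by rewrite -e'; congr (_ + _); rewrite tofracD -mul_polyC tofracM mulrC.
  by case: (i == k); rewrite ?mulr1n ?mulr0n ?polyC1 ?polyC0 ?tofrac1 ?tofrac0.
have M0 j i k : M j i k = 0.
  apply: (@reg_simple_pole _ (alpha j)).
  have := eik i k; rewrite (bigD1 j) //= -addrA => /(canRL (addrK _)) ->.
  apply: regB; first exact: reg_poly.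
  apply: regD; last exact: reg_poly.
  apply: reg_sum => m mj; apply: regM; first exact: regC.
  by apply: reg_XBCV; rewrite eq_sym (inj_eq alpha_inj).
have UV i k : U i k *: 'X + (V i k)%:P = ((1%:M : 'M[C]_p) i k)%:P.
  apply/eqP; rewrite -tofrac_eq -eik big1 ?add0r // => j _.
  by rewrite M0 /ratC /= polyC0 tofrac0 mul0r.
split=> [j||]; apply/matrixP => i k; first by rewrite M0 mxE.
  have /polyP/(_ 1%N) := UV i k.
  by rewrite coefD coefZ coefX !coefC !mxE /= mulr1 addr0.
have /polyP/(_ 0%N) := UV i k.
by rewrite coefD coefZ coefX !coefC /= mulr0 add0r.
Qed.

Lemma mulV2fM (F : fieldType) (m c d : F) : d != 0 ->
  d ^- 2 * (m * c * d) = m * (c / d).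
Proof. by move=> dN0; field. Qed.

(** * The inverse of the transformed pencil *)

Section MobiusResolvent.
Variables (C : numClosedFieldType) (p N : nat) (A B : 'M[C]_p).
Variables (alpha : 'I_N -> C) (P : 'I_N -> 'M[C]_p) (P0 : 'M[C]_p).
Local Notation K := {fraction {poly C}}.
Local Notation X := (FracField.tofrac ('X : {poly C})).
Local Notation ratC := (@FracField.tofrac {poly C} \o polyC).
Local Notation ratmx := (map_mx ratC).
Local Notation F := (invmx (fracquad A B)).
Hypothesis hA : A = A^t*.
Hypothesis detQ : \det (fracquad A B) != 0.
Hypothesis alpha_inj : injective alpha.
Hypothesis regF :
  forall c, (forall j, alpha j <> c) -> forall i k, reg c (F i k).
Hypothesis regFP : forall j i k,
  reg (alpha j) (F i k - ratC (P j i k) / (X - ratC (alpha j))).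
Hypothesis regF0 : forall i k, reg 0 (F i k - ratC (P0 i k) / X).

Lemma sum_residues : \sum_j P j = P0^t*.
Proof.
apply/matrixP => i k; rewrite summxE !mxE.
by have [_ ->] := invmx_fracquad_strictly_proper hA detQ alpha_inj regF regFP
  regF0 i k.
Qed.

Lemma invmx_fracquadE : F = \sum_j (X - ratC (alpha j))^-1 *: ratmx (P j).
Proof.
apply/matrixP => i k; rewrite summxE.
have [-> _] := invmx_fracquad_strictly_proper hA detQ alpha_inj regF regFP
  regF0 i k.
by apply: eq_bigr => j _; rewrite !mxE mulrC.
Qed.

Lemma residue_identities :
  [/\ forall j, P j *m quadmx (alpha j) B A (B^t*) = 0,
      P0^t* *m B = 0 &
      \sum_j alpha j *: (P j *m B) + P0^t* *m A = 1%:M].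
Proof.
rewrite -sum_residues; apply: (partial_fractions_coef alpha_inj).
rewrite -partial_fractions_quad; last by move=> j; exact: ratXBC_neq0.
rewrite -invmx_fracquadE; apply: mulVmx.
exact: fracquad_unit.
Qed.

Variables (a b : C) (D : 'M[C]_p) (mu : nat).
Hypothesis det1 : a * a^* - b * b^* = 1.
Let d : K := - ratC b^* * X + ratC a.
Let y : K := (ratC a^* * X + - ratC b) / d.
Let gQ : 'M[K]_p := quadmx X
  (- ((ratC a^* * ratC b^*) *: ratmx A) + ratC a^* ^+ 2 *: ratmx B
     + ratC b^* ^+ 2 *: ratmx (B^t* ))
  ((ratC a * ratC a^* + ratC b * ratC b^*) *: ratmx A
     - 2 *: ((ratC a^* * ratC b) *: ratmx B
             + (ratC a * ratC b^*) *: ratmx (B^t* )))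
  (- ((ratC a * ratC b) *: ratmx A) + ratC a ^+ 2 *: ratmx (B^t* )
     + ratC b ^+ 2 *: ratmx B).
Let grhs : 'M[K]_p := rhsmx mu X
  (- ((ratC a^* * ratC b^*) *: ratmx A) + ratC a^* ^+ 2 *: ratmx B
     + ratC b^* ^+ 2 *: ratmx (B^t* ))
  ((ratC a * ratC a^* + ratC b * ratC b^*) *: ratmx A
     - 2 *: ((ratC a^* * ratC b) *: ratmx B
             + (ratC a * ratC b^*) *: ratmx (B^t* )))
  (ratmx D).
(** Stand-ins for 1/(z - g.alpha_j) and 1/(z - g.oo), read as 0 when the point is infinite; abstract
    values avoid case distinctions here. *)
Variables (s : 'I_N -> K) (soo : K).
Hypothesis dN0 : d != 0.
Hypothesis yN : forall j, y - ratC (alpha j) != 0.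
Hypothesis sE : forall j, d ^- 2 / (y - ratC (alpha j)) = s j - soo.
Hypothesis sooE : ratC b^* / d = - soo.

Let G := \sum_j (y - ratC (alpha j))^-1 *: ratmx (P j).

(** The residue identities annihilate the polar and linear terms and make the constant term 1,
    whatever the point [y]; no substitution into [F] itself takes place. *)
Lemma mobius_resolvent_mul :
  G *m quadmx y (ratmx B) (ratmx A) (ratmx (B^t* )) = 1%:M.
Proof.
have [PQ PB PA] := residue_identities.
rewrite partial_fractions_quad // sum_residues PB PA map_mx0 scaler0 add0r.
rewrite map_mx1 big1 ?add0r // => j _.
by rewrite PQ map_mx0 scaler0.
Qed.

Lemma gQE : gQ = d ^+ 2 *: quadmx y (ratmx B) (ratmx A) (ratmx (B^t* )).
Proof. exact: quadmx_mobius. Qed.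

Lemma mobius_quad_inv : (d ^- 2 *: G) *m gQ = 1%:M.
Proof.
rewrite gQE -scalemxAl -scalemxAr mobius_resolvent_mul scalerA.
have -> : d ^- 2 * d ^+ 2 = 1 := mulVf (expf_neq0 2 dN0).
exact: scale1r.
Qed.

Lemma mobius_quad_unit : gQ \in unitmx.
Proof. by have [] := mulmx1_unit mobius_quad_inv. Qed.

Lemma mobius_invmx : invmx gQ = d ^- 2 *: G.
Proof.
by rewrite -[RHS](mulmxK mobius_quad_unit) mobius_quad_inv mul1mx.
Qed.

(** Write - mu alpha B - (mu/2) A as (mu/2) A - mu (alpha B + A) and sum: the last bracket adds up
    to the identity by [residue_identities]. *)
Lemma residue_rhs_sum :
  \sum_j P j *m (- (mu%:R *: (alpha j *: B + 2^-1 *: A)) + D)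
  = P0^t* *m ((mu%:R / 2) *: A + D) - mu%:R *: 1%:M.
Proof.
have [_ _ <-] := residue_identities.
rewrite -sum_residues !mulmx_suml -big_split scaler_sumr -sumrB.
apply: eq_bigr => j _ /=; rewrite !mulmxDr mulmxN -!scalemxAr.
rewrite mulmxDr -!scalemxAr.
move: (P j *m B) (P j *m A) (P j *m D) => U V W.
by apply/matrixP => i k; rewrite !mxE; field.
Qed.

Lemma mobius_resolvent :
  invmx gQ *m grhs =
    \sum_j s j *: ratmx (P j *m (- (mu%:R *: (alpha j *: B + 2^-1 *: A)) + D))
    - soo *: ratmx (P0^t* *m ((mu%:R / 2) *: A + D)).
Proof.
have twoN0 : 2 != 0 :> K.
  by rewrite -(rmorph_nat ratC) tofrac_eq0 polyC_eq0 pnatr_eq0.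
have Kdet1 : ratC a * ratC a^* - ratC b * ratC b^* = 1.
  by rewrite -!rmorphM -rmorphB det1 rmorph1.
have [PQ PB PA] := residue_identities.
have rE j : rhsmx mu (alpha j) B A D =
    - (mu%:R *: (alpha j *: B + 2^-1 *: A)) + D.
  by rewrite /rhsmx scalerDr !scalerA opprD.
rewrite mobius_invmx /grhs (rhsmx_mobius _ _ _ _ _ dN0 twoN0 Kdet1) -/d -/y.
rewrite -scalemxAl mulmxDr -scalemxAr mobius_resolvent_mul.
rewrite partial_fractions_rhs // sum_residues PB map_mx0 scaler0 subr0.
rewrite scalerDr scalerA scaler_sumr.
(* The multiple of Q(y) in the right-hand side becomes a scalar matrix once multiplied by the
   resolvent, and contributes only to the term at g.oo. *)
have -> : d ^- 2 * (mu%:R * ratC b^* * d) = - (mu%:R * soo).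
  have := @mulV2fM K mu%:R (ratC b^* ) d dN0.
  by rewrite sooE mulrN.
under eq_bigr => j _ do rewrite scalerA sE scalerBl rE.
rewrite sumrB addrCA; congr (_ + _).
(* Only multiples of [soo] remain; [residue_rhs_sum] cancels the scalar [mu] among them. *)
rewrite -scaler_sumr scaleNr -opprD; congr (- _).
rewrite [_ * soo]mulrC -[(soo * _) *: _]scalerA -scalerDr; congr (_ *: _).
have fsum (M : 'I_N -> 'M[C]_p) : ratmx (\sum_j M j) = \sum_j ratmx (M j).
  exact: raddf_sum.
rewrite -fsum residue_rhs_sum map_mxB map_mxZ map_mx1 rmorph_nat addrC.
exact: subrK.
Qed.
End MobiusResolvent.

(** * The differential equation on the disc *)

Lemma is_derive1_comp_num (K : numFieldType) (f g : K -> K) (x a b : K) :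
  is_derive x 1 f a -> is_derive (f x) 1 g b -> is_derive x 1 (g \o f) (b * a).
Proof.
move=> [df <-] [dg <-].
have Df := (derivable1_diffP f x).1 df.
have Dg := (derivable1_diffP g (f x)).1 dg.
have Dgf : differentiable (g \o f) x by exact: differentiable_comp.
split; first exact/derivable1_diffP.
rewrite -!derive1E derive1E' // diff_comp //= !derive1E' //.
(* As a multiple of 1, the argument can be pulled out of the differential by linearity. *)
rewrite -[X in 'd g _ X = _]mulr1.
by rewrite [LHS]linearZ mulrC.
Qed.

Section MobiusDerivative.
Variable K : numFieldType.
Implicit Types c e z : K.

Lemma is_derive_affine c e z : is_derive z 1 (fun w => c * w + e) c.
Proof.
have -> : (fun w => c * w + e) = (c *: (id : K -> K)) + cst e :> (K -> K).
  by apply/funext => w.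
apply: is_derive_eq.
by rewrite addr0; exact: mulr1.
Qed.

Lemma is_derive_affineV c e z : c * z + e != 0 ->
  is_derive z 1 (fun w => (c * w + e)^-1) (- (c / (c * z + e) ^+ 2)).
Proof.
move=> d0; have [der dE] := is_derive_affine c e z.
split; first exact: derivableV.
by rewrite deriveV // dE /GRing.scale /= mulNr mulrC.
Qed.

Lemma is_derive_mobius c e c' e' z : c' * z + e' != 0 ->
  is_derive z 1 (fun w => (c * w + e) / (c' * w + e'))
    ((c * e' - e * c') / (c' * z + e') ^+ 2).
Proof.
move=> d0; have d1 := is_derive_affine c e z; have d2 := is_derive_affineV d0.
have -> : (fun w => (c * w + e) / (c' * w + e')) =
  (fun w => c * w + e) * (fun w => (c' * w + e')^-1) :> (K -> K) by [].
apply: is_derive_eq; rewrite /GRing.scale /=.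
by field.
Qed.

Lemma is_derive_mobius_twist m c e z (y f : K -> K) (y' : K) :
  c * z + e != 0 -> is_derive z 1 y y' -> derivable f (y z) 1 ->
  is_derive z 1 (fun w => (c * w + e) ^- m * f (y w))
    (- (m%:R * c * (c * z + e) ^- m.+1 * f (y z))
     + (c * z + e) ^- m * (y' * derive1 f (y z))).
Proof.
move=> d0 dy /derivableP df; rewrite derive1E.
have dV := is_derive_affineV d0.
have dfy := is_derive1_comp_num dy df.
have -> : (fun w => (c * w + e) ^- m * f (y w)) =
  ((fun w => (c * w + e)^-1) ^+ m) * (f \o y) :> (K -> K).
  by apply/funext => w; rewrite -exprVn mulrfctE exprfctE.
apply: is_derive_eq.
rewrite fctE /GRing.scale /= -!exprVn; move: (_^-1) (f _) ('D_1 f _) => v u w.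
by case: m => [|n]; rewrite ?mulr0n /= ?exprS; ring.
Qed.
End MobiusDerivative.

Lemma twist_scalar (F : fieldType) (m c d u v : F) n :
  - (m * - c / d ^+ n.+1 * u) + d ^- n * (1 / d ^+ 2 * v)
  = m * c * d ^- n.+1 * u + d ^- n.+2 * v.
Proof.
by rewrite mul1r [_ * (_ * v)]mulrA -invfM -exprD addn2 mulrN !mulNr opprK.
Qed.

Lemma twist_scalar2 (F : fieldType) (m c d : F) n : d != 0 ->
  d ^+ 2 * (m * c * d ^- n.+1) = m * c * d * d ^- n.
Proof.
move=> d0; rewrite [d ^+ n.+1]exprS.
by move: (d ^+ n) (expf_neq0 n d0) => e eN0; field; rewrite eN0 d0.
Qed.

Lemma twist_scalar3 (F : fieldType) (d : F) n : d != 0 ->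
  d ^+ 2 * d ^- n.+2 = d ^- n.
Proof.
move=> d0; rewrite [d ^+ n.+2]exprS [d ^+ n.+1]exprS.
by move: (d ^+ n) (expf_neq0 n d0) => e eN0; field; rewrite eN0 d0.
Qed.

(** The derivative of the factor [d ^- n] and the extra multiple of [Q] in [s] contribute the same
    term to both sides; cancelling it leaves the old equation times [d ^- n]. *)
Lemma twist_equiv (F : fieldType) (p n : nat) (Q S q s : 'M[F]_p)
    (u v t w : 'cV[F]_p) (m c d : F) : d != 0 ->
  q = d ^+ 2 *: Q -> s = (m * c * d) *: Q + S -> t = d ^- n *: u ->
  w = (m * c * d ^- n.+1) *: u + d ^- n.+2 *: v ->
  Q *m v = S *m u <-> q *m w = s *m t.
Proof.
move=> d0 -> -> -> ->; rewrite mulmxDr mulmxDl -!scalemxAl -!scalemxAr !scalerA.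
rewrite (twist_scalar2 _ _ _ d0) (twist_scalar3 _ d0).
split=> [->//|/addrI/scalerI]; apply.
by rewrite invr_eq0 expf_neq0.
Qed.

Lemma col_lincomb (F : fieldType) (p : nat) (g v : 'I_p -> F) (w : 'cV[F]_p)
    (k l : F) :
  (forall i, g i = k * w i 0 + l * v i) ->
  \col_i g i = k *: w + l *: \col_i v i.
Proof. by move=> gE; apply/matrixP => i j; rewrite !mxE gE ord1. Qed.

(** * The action of SU(1,1) on the disc and on solutions *)

Section DiscAutomorphism.
Variables (R : realType) (a b : Cplx R).
Hypothesis hg : `|a| ^+ 2 - `|b| ^+ 2 = 1.

Lemma su11_det : a * a^* - b * b^* = 1.
Proof. by rewrite -!normCK. Qed.

Lemma invmx_su11 : invmx (su11 a b) =
  \matrix_(i < 2, j < 2)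
    if i == 0 then (if j == 0 then a^* else - b)
    else (if j == 0 then - b^* else a).
Proof.
set M := \matrix_(i, j) _.
have det1 := su11_det.
have Mg : M *m su11 a b = 1%:M.
  apply/matrixP => i j; rewrite !mxE !big_ord_recl big_ord0 !mxE /= addr0.
  case: i => [[|[|//]] hi]; case: j => [[|[|//]] hj]; rewrite /= -?det1; ring.
have [_ gU] := mulmx1_unit Mg.
by rewrite -[LHS]mul1mx -Mg mulmxK.
Qed.

(** Denominator of the Moebius map of g^-1; [cmob] is that map. *)
Definition cden (z : Cplx R) : Cplx R := - b^* * z + a.
Definition cmob (z : Cplx R) : Cplx R := (a^* * z + - b) / cden z.

Lemma tauE (mu p : nat) (f : Cplx R -> 'cV[Cplx R]_p) z :
  tau mu (su11 a b) f z = cden z ^- mu *: f (cmob z).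
Proof. by rewrite /tau invmx_su11 !mxE. Qed.

(** The squared moduli of denominator and numerator differ by 1 - |z|^2, by the determinant
    relation. *)
Lemma cmob_disc z : disc z -> cden z != 0 /\ disc (cmob z).
Proof.
rewrite /disc /= => z1.
have e : `|cden z| ^+ 2 - `|a^* * z + - b| ^+ 2 = 1 - `|z| ^+ 2.
  rewrite !normCK /cden !rmorphD !rmorphM !rmorphN /= !conjCK.
  transitivity ((a * a^* - b * b^*) * (1 - z * z^*)); first by ring.
  by rewrite su11_det mul1r.
have lt : `|a^* * z + - b| ^+ 2 < `|cden z| ^+ 2.
  by rewrite -subr_gt0 e subr_gt0 expr_lt1.
have d0 : cden z != 0.
  apply: contraTneq lt => ->; rewrite normr0 expr0n /=.
  by rewrite le_gtF // exprn_ge0.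
split=> //; rewrite /cmob normf_div ltr_pdivrMr ?normr_gt0 // mul1r.
by rewrite -(ltr_pXn2r (n := 2)) ?nnegrE.
Qed.

Lemma gAE (p : nat) (A B : 'M[Cplx R]_p) : gA a b A B =
  (a * a^* + b * b^*) *: A - 2 *: ((a^* * b) *: B + (a * b^*) *: B^t*).
Proof. by rewrite /gA !normCK. Qed.

Lemma gBE (p : nat) (A B : 'M[Cplx R]_p) : gB a b A B =
  - ((a^* * b^*) *: A) + a^* ^+ 2 *: B + b^* ^+ 2 *: B^t*.
Proof. by rewrite /gB rmorphM. Qed.

Lemma gB_adj (p : nat) (A B : 'M[Cplx R]_p) : A = A^t* -> (gB a b A B)^t* =
  - ((a * b) *: A) + a ^+ 2 *: B^t* + b ^+ 2 *: B.
Proof.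
move=> hA; rewrite gBE; apply/matrixP => i j; rewrite !mxE.
have -> : A i j = (A j i)^* by rewrite [in LHS]hA !mxE.
by rewrite !rmorphD rmorphN !rmorphM /= !conjCK.
Qed.

Lemma quadmx_gAB (p : nat) (A B : 'M[Cplx R]_p) z : A = A^t* -> cden z != 0 ->
  quadmx z (gB a b A B) (gA a b A B) ((gB a b A B)^t* )
  = cden z ^+ 2 *: quadmx (cmob z) B A (B^t* ).
Proof.
by move=> hA d0; rewrite (gB_adj B hA) gBE gAE; exact: quadmx_mobius.
Qed.

Lemma rhsmx_gAB (p mu : nat) (A B C : 'M[Cplx R]_p) z : cden z != 0 ->
  rhsmx mu z (gB a b A B) (gA a b A B) C
  = (mu%:R * b^* * cden z) *: quadmx (cmob z) B A (B^t* )
    + rhsmx mu (cmob z) B A C.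
Proof.
move=> d0; rewrite gBE gAE.
have twoN0 : 2 != 0 :> Cplx R by rewrite pnatr_eq0.
exact: (rhsmx_mobius _ _ _ _ _ d0 twoN0 su11_det).
Qed.

Lemma solves_mobius (p mu : nat) (A B C : 'M[Cplx R]_p)
    (f : Cplx R -> 'cV[Cplx R]_p) (z : Cplx R) :
  A = A^t* -> disc z -> (forall i, derivable (fun w => f w i 0) (cmob z) 1) ->
  (forall i, derivable (fun w => tau mu (su11 a b) f w i 0) z 1) /\
  (quadmx (cmob z) B A (B^t* ) *m (\col_i derive1 (fun w => f w i 0) (cmob z))
      = rhsmx mu (cmob z) B A C *m f (cmob z) <->
   quadmx z (gB a b A B) (gA a b A B) ((gB a b A B)^t* )
      *m (\col_i derive1 (fun w => tau mu (su11 a b) f w i 0) z)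
      = rhsmx mu z (gB a b A B) (gA a b A B) C *m tau mu (su11 a b) f z).
Proof.
move=> hA z1 fd; have [d0 y1] := cmob_disc z1.
have det1 := su11_det.
have taui i : (fun w => tau mu (su11 a b) f w i 0) =
    fun w => (- b^* * w + a) ^- mu * f ((a^* * w + - b) / (- b^* * w + a)) i 0.
  by apply/funext => w; rewrite tauE mxE.
have dtau i : is_derive z 1 (fun w => tau mu (su11 a b) f w i 0)
    (mu%:R * b^* * cden z ^- mu.+1 * f (cmob z) i 0
     + cden z ^- mu.+2 * derive1 (fun w => f w i 0) (cmob z)).
  rewrite taui.
  have dy := is_derive_mobius (a^*) (- b) d0.
  have := is_derive_mobius_twist mu d0 dy (fd i).
  move=> dd; apply: (is_derive_eq dd).
  (* The determinant of g^-1 is the numerator of the derivative of [cmob]. *)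
  have -> : a^* * a - - b * - b^* = 1 by rewrite mulrNN mulrC.
  exact: twist_scalar.
split; first by move=> i; have [] := dtau i.
have colE : \col_i derive1 (fun w => tau mu (su11 a b) f w i 0) z =
   (mu%:R * b^* * cden z ^- mu.+1) *: f (cmob z)
   + cden z ^- mu.+2 *: \col_i derive1 (fun w => f w i 0) (cmob z).
  apply: col_lincomb => i.
  rewrite derive1E.
  have [_ dE] := dtau i.
  exact: dE.
exact: (twist_equiv d0 (quadmx_gAB B hA d0) (rhsmx_gAB mu A B C d0)
  (tauE mu f z) colE).
Qed.
End DiscAutomorphism.

Lemma mobius_cancel (F : fieldType) (a b a' b' w : F) :
  a * a' - b * b' = 1 -> b' * w + a' != 0 ->
  let z := (a * w + b) / (b' * w + a') in
  (a' * z + - b) / (- b' * z + a) = w.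
Proof.
move=> det1 d0 z.
have -> : a' * z + - b = w / (b' * w + a').
  transitivity (w * (a * a' - b * b') / (b' * w + a')).
    by rewrite /z; field.
  by rewrite det1 mulr1.
have -> : - b' * z + a = (b' * w + a')^-1.
  transitivity ((a * a' - b * b') / (b' * w + a')).
    by rewrite /z; field.
  by rewrite det1 mul1r.
by rewrite invrK mulfVK.
Qed.

(** The preimage is g.w, obtained as [cmob] for the inverse matrix, with entries [a^*] and [- b]; so
    [cmob_disc] places it in the disc. *)
Lemma cmob_disc_surj (R : realType) (a b w : Cplx R) :
  `|a| ^+ 2 - `|b| ^+ 2 = 1 -> disc w -> exists2 z, disc z & cmob a b z = w.
Proof.
move=> hg w1.
have hg' : `|a^*| ^+ 2 - `|- b| ^+ 2 = 1 by rewrite norm_conjC normrN.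
have [d0 z1] := cmob_disc hg' w1.
exists (cmob a^* (- b) w) => //; move: d0.
rewrite /cmob /cden rmorphN /= !opprK conjCK => d0.
exact: (mobius_cancel (su11_det hg) d0).
Qed.

Lemma solves_tau (R : realType) (p mu : nat) (A B C : 'M[Cplx R]_p)
    (a b : Cplx R) (f : Cplx R -> 'cV[Cplx R]_p) :
  A = A^t* -> `|a| ^+ 2 - `|b| ^+ 2 = 1 -> Hmu_vec mu f ->
  solves mu A B C f <->
  solves mu (gA a b A B) (gB a b A B) C (tau mu (su11 a b) f).
Proof.
move=> hA hg fH.
have fd w i : disc w -> derivable (fun v => f v i 0) w 1.
  by move=> w1; have [+ _] := fH i; exact.
have eqv (z : Cplx R) (z1 : disc z) :=
  solves_mobius hg mu B C hA z1 (fun i => fd _ i (cmob_disc hg z1).2).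
split=> sol.
  move=> z z1; have [der eqvz] := eqv z z1; split => //.
  by apply/eqvz; have [] := sol _ (cmob_disc hg z1).2.
(* For the converse, every point of the disc is reached by [cmob], so the pointwise equivalence
   covers it. *)
move=> w w1; split=> [i|]; first exact: fd.
have [z z1 zw] := cmob_disc_surj hg w1; rewrite -zw.
by have [_ eqvz] := eqv z z1; apply/eqvz; have [] := sol z z1.
Qed.

(** * From poles and residues to the rational identity *)

Section RegularMatrix.
Variable C : fieldType.
Local Notation K := {fraction {poly C}}.
Local Notation tofrac := (@FracField.tofrac {poly C}).
Local Notation X := (tofrac 'X).
Local Notation ratC := (tofrac \o polyC).
Implicit Types (c : C) (p : nat).

Lemma reg_prod c (I : Type) (r : seq I) (P : pred I) (F : I -> K) :
  (forall i, P i -> reg c (F i)) -> reg c (\prod_(i <- r | P i) F i).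
Proof.
move=> rF; apply: (big_ind (reg c)) => //; last exact: regM.
by rewrite -tofrac1; exact: reg_poly.
Qed.

Lemma reg_det c p (M : 'M[K]_p) :
  (forall i k, reg c (M i k)) -> reg c (\det M).
Proof.
move=> rM; apply: reg_sum => s _; apply: regM; last exact: reg_prod.
by apply: regX; apply: regN; rewrite -tofrac1; exact: reg_poly.
Qed.

Lemma reg_map_tofrac_invmx c p (M : 'M[{poly C}]_p) :
  (\det M).[c] != 0 ->
  forall i k, reg c (invmx (map_mx tofrac M) i k).
Proof.
move=> dM i k; rewrite /invmx; case: ifP => _; last first.
  (* On a non-invertible matrix [invmx] is the identity, so the entries are polynomials. *)
  by rewrite mxE; exact: reg_poly.
rewrite mxE -map_mx_adj det_map_mx mxE; apply: regM; last exact: reg_poly.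
exact: reg_inv.
Qed.

(** If every entry of the inverse were regular, so would be its determinant 1 / det M, although det
    M vanishes at [c]. *)
Lemma pole_map_tofrac_invmx c p (M : 'M[{poly C}]_p) :
  \det (map_mx tofrac M) != 0 -> (\det M).[c] = 0 ->
  ~ forall i k, reg c (invmx (map_mx tofrac M) i k).
Proof.
move=> dM0 dMc /reg_det [n [d [dc]]].
rewrite det_inv det_map_mx => e; move: dM0; rewrite det_map_mx => dM0.
have tdN0 := horner_neq0 dc.
have /(congr1 (horner^~ c)) : d = n * \det M.
  apply/eqP; rewrite -tofrac_eq tofracM -[tofrac n](divfK tdN0) -e.
  by rewrite mulrAC (mulVf dM0) mul1r.
by rewrite /= hornerM dMc mulr0 => dc0; rewrite dc0 eqxx in dc.
Qed.

(** [is_residue] allows a principal part of any length; at a pole of order at most 1, uniqueness of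
    principal parts reduces it to its first term. *)
Lemma reg_residue c x k (l : nat -> C) :
  reg c ((X - ratC c) * x) ->
  reg c (x - \sum_(j < k.+1) ratC (l j) * (X - ratC c) ^- j.+1) ->
  reg c (x - ratC (l 0%N) / (X - ratC c)).
Proof.
move=> /reg_split[m rm] rl; suff -> : l 0%N = m by [].
apply/eqP; rewrite -subr_eq0; apply/eqP.
pose l' j := if j is 0 then l 0%N - m else l j.
suff rl' : reg c (\sum_(j < k.+1) ratC (l' j) * (X - ratC c) ^- j.+1).
  exact: (reg_principal_part rl' (ltn0Sn k)).
have -> : \sum_(j < k.+1) ratC (l' j) * (X - ratC c) ^- j.+1 =
  (x - ratC m / (X - ratC c))
  - (x - \sum_(j < k.+1) ratC (l j) * (X - ratC c) ^- j.+1); last exact: regB.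
rewrite !big_ord_recl expr1 rmorphB mulrBl; ring.
Qed.
End RegularMatrix.

Section QuadraticPolynomial.
Variables (C : numClosedFieldType) (p : nat) (A B : 'M[C]_p).

(** The pencil with polynomial entries, so that its determinant can be evaluated at a point. *)
Definition polyquad : 'M[{poly C}]_p :=
  'X^2 *: map_mx polyC B + 'X *: map_mx polyC A + map_mx polyC (B^t*).

Lemma fracquad_poly : fracquad A B = map_mx (@FracField.tofrac _) polyquad.
Proof.
apply/matrixP => i j; rewrite !mxE [RHS]tofracD [X in _ = X + _]tofracD.
by rewrite [X in _ = X + _ + _]tofracM tofracXn [X in _ = _ + X + _]tofracM.
Qed.

Lemma det_polyquad0 : (\det polyquad).[0] = (\det B)^*.
Proof.
rewrite -horner_evalE -det_map_mx -det_map_mx -det_tr; congr (\det _).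
apply/matrixP => i j; rewrite !mxE /= /horner_eval.
by rewrite !hornerD !hornerM !hornerX !hornerC !mul0r !add0r.
Qed.
End QuadraticPolynomial.

Lemma mobius_sub (F : fieldType) (a b a' b' x v : F) :
  - b' * x + a != 0 ->
  (a' * x + - b) / (- b' * x + a) - v =
  ((b' * v + a') * x - (a * v + b)) / (- b' * x + a).
Proof. by move=> d0; field. Qed.

Lemma mobius_sub_neq0 (F : fieldType) (a b a' b' x v : F) :
  - b' * x + a != 0 -> (b' * v + a') * x - (a * v + b) != 0 ->
  (a' * x + - b) / (- b' * x + a) - v != 0.
Proof.
by move=> d0 n0; rewrite mobius_sub // mulf_neq0 // invr_eq0.
Qed.

(** The left side is 1 / (d n). Over the common denominator, the numerator of the right side is the
    determinant [a * a' - b * b'], which is 1. *)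
Lemma mobius_simple_frac (F : fieldType) (a b a' b' x v s t : F) :
  let d := - b' * x + a in let n := (b' * v + a') * x - (a * v + b) in
  a * a' - b * b' = 1 -> d != 0 -> n != 0 ->
  s = (b' * v + a') / n -> b' / d = - t ->
  d ^- 2 / ((a' * x + - b) / d - v) = s - t.
Proof.
move=> d n det1 d0 n0 -> <-; rewrite mobius_sub // -/d -/n.
have -> : (b' * v + a') / n + b' / d = ((b' * v + a') * d + b' * n) / (n * d).
  by field; rewrite d0 n0.
have -> : (b' * v + a') * d + b' * n = a * a' - b * b'.
  by rewrite /d /n; ring.
by rewrite det1; field; rewrite d0 n0.
Qed.

Lemma map_gAB (F K : fieldType) (f : {rmorphism F -> K}) (p : nat)
    (a b a' b' : F) (A B D : 'M[F]_p) :
  [/\ map_mx f (- ((a' * b') *: A) + a' ^+ 2 *: B + b' ^+ 2 *: D) =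
      - ((f a' * f b') *: map_mx f A) + f a' ^+ 2 *: map_mx f B
        + f b' ^+ 2 *: map_mx f D,
    map_mx f ((a * a' + b * b') *: A - 2 *: ((a' * b) *: B + (a * b') *: D)) =
      (f a * f a' + f b * f b') *: map_mx f A
      - 2 *: ((f a' * f b) *: map_mx f B + (f a * f b') *: map_mx f D) &
    map_mx f (- ((a * b) *: A) + a ^+ 2 *: D + b ^+ 2 *: B) =
      - ((f a * f b) *: map_mx f A) + f a ^+ 2 *: map_mx f D
        + f b ^+ 2 *: map_mx f B].
Proof.
by split; rewrite !(map_mxD, map_mxB, map_mxN, map_mxZ, rmorphXn, rmorphD,
  rmorph1, rmorphM).
Qed.

Section Assembly.
Variables (R : realType) (p : nat) (A B : 'M[Cplx R]_p).
Local Notation C := (Cplx R).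
Local Notation Q := (fracquad A B).

Lemma pole0 : \det Q != 0 -> \det B = 0 -> is_pole (invmx Q) 0.
Proof.
rewrite fracquad_poly => dQ dB; apply: pole_map_tofrac_invmx => //.
by rewrite det_polyquad0 dB rmorph0.
Qed.

Lemma reg0_invmx : \det B != 0 -> regular_at (invmx Q) 0.
Proof.
move=> dB; rewrite fracquad_poly; apply: reg_map_tofrac_invmx.
by rewrite det_polyquad0 conjC_eq0.
Qed.

Lemma simple_pole_residue (F : 'M[ratfun R]_p) c P :
  pole_of_order F c 1 -> is_residue F c P ->
  forall i k, reg c (F i k - FracField.tofrac (P i k)%:P /
    (FracField.tofrac 'X - FracField.tofrac c%:P)).
Proof.
move=> [_ rF _] [m [L [<- rL]]] i k.
apply: (@reg_residue _ c (F i k) m (fun j => L j i k)).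
  by have := rF i k; rewrite mxE expr1.
have := rL i k; rewrite !mxE summxE.
by under eq_bigr => j _ do rewrite !mxE mulrC.
Qed.
End Assembly.

Section SimpleFractions.
Variables (R : realType) (a b : Cplx R).
Hypothesis hg : `|a| ^+ 2 - `|b| ^+ 2 = 1.
Local Notation K := {fraction {poly (Cplx R)}}.
Local Notation X := (FracField.tofrac ('X : {poly (Cplx R)})).
Local Notation ratC := (@FracField.tofrac {poly (Cplx R)} \o polyC).
Let d : K := - ratC b^* * X + ratC a.
(** The numerator of y - v over the denominator [d]; it is constant exactly when g.v is infinite. *)
Let numer (v : Cplx R) : K :=
  (ratC b^* * ratC v + ratC a^*) * X - (ratC a * ratC v + ratC b).

Lemma ratC_det : ratC a * ratC a^* - ratC b * ratC b^* = 1.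
Proof. by rewrite -!rmorphM -rmorphB (su11_det hg) rmorph1. Qed.

Lemma cden_poly : d = FracField.tofrac (- b^* *: 'X + a%:P).
Proof. by rewrite tofracD -mul_polyC tofracM polyCN tofracN. Qed.

Lemma numer_poly v :
  numer v = FracField.tofrac ((b^* * v + a^*) *: 'X - (a * v + b)%:P).
Proof.
by rewrite tofracB -mul_polyC tofracM !polyCD !polyCM !tofracD !tofracM.
Qed.

Lemma affine_neq0 (c e : Cplx R) : ~ (c = 0 /\ e = 0) ->
  FracField.tofrac (c *: 'X + e%:P) != 0.
Proof.
move=> ce; rewrite tofrac_eq0; apply/eqP => /polyP q0; apply: ce.
have := q0 1%N; have := q0 0%N.
by rewrite !coefD !coefZ !coefX !coefC /= !mulr0 mulr1 add0r addr0.
Qed.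

Lemma su11_a_neq0 : a != 0.
Proof.
apply: contra_eq_neq hg => ->; rewrite normr0 expr0n sub0r /=.
by rewrite lt_eqF // (le_lt_trans _ ltr01) // oppr_le0 exprn_ge0.
Qed.

Lemma cden_frac_neq0 : d != 0.
Proof.
rewrite cden_poly; apply: affine_neq0 => -[_ a0].
by have := su11_a_neq0; rewrite a0 eqxx.
Qed.

Lemma numer_neq0 v : numer v != 0.
Proof.
rewrite numer_poly -polyCN; apply: affine_neq0 => -[c0 /eqP].
rewrite oppr_eq0 => /eqP e0; have := oner_neq0 (Cplx R).
(* The determinant is a combination of the two coefficients, so they cannot vanish together. *)
have -> : 1 = a * (b^* * v + a^*) - b^* * (a * v + b) :> Cplx R.
  by rewrite -(su11_det hg); ring.
by rewrite c0 e0 !mulr0 subrr eqxx.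
Qed.

Lemma simple_frac_mobius v : simple_frac (mobius a b (Some v)) =
  (ratC b^* * ratC v + ratC a^*) / numer v.
Proof.
have cE : ratC b^* * ratC v + ratC a^* = ratC (b^* * v + a^*).
  by rewrite rmorphD rmorphM.
rewrite /mobius; case: eqP => [c0|/eqP c0].
  by rewrite cE c0 rmorph0 mul0r.
have eE : ratC a * ratC v + ratC b = ratC (b^* * v + a^*) *
    ratC ((a * v + b) / (b^* * v + a^*)).
  by rewrite -[RHS]rmorphM mulrCA (divff c0) mulr1 rmorphD rmorphM.
have rc0 : ratC (b^* * v + a^*) != 0 by rewrite tofrac_eq0 polyC_eq0.
rewrite /numer cE eE -mulrBr invfM mulrA (mulfV rc0) mul1r.
by [].
Qed.

Lemma simple_frac_mobius_oo :
  ratC b^* / d = - simple_frac (mobius a b None).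
Proof.
rewrite /mobius; case: eqP => [b0|/eqP b0].
  by rewrite b0 !rmorph0 mul0r oppr0.
have rb0 : ratC b^* != 0 by rewrite tofrac_eq0 polyC_eq0 conjC_eq0.
have -> : d = - ratC b^* * (X - ratC (a / b^*)).
  rewrite mulrBr !mulNr opprK -rmorphM mulrCA divff ?conjC_eq0 // mulr1.
  by rewrite /d mulNr.
by rewrite invfM invrN mulrA mulrN (mulfV rb0) mulN1r.
Qed.
End SimpleFractions.

Section RationalIdentity.
Variables (R : realType) (p mu N : nat) (A B D : 'M[Cplx R]_p) (a b : Cplx R).
Variables (alpha : 'I_N -> Cplx R) (P : 'I_N -> 'M[Cplx R]_p).
Variable P0 : 'M[Cplx R]_p.
Local Notation X := (FracField.tofrac ('X : {poly (Cplx R)})).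
Local Notation ratC := (@FracField.tofrac {poly (Cplx R)} \o polyC).
Local Notation F := (invmx (ratquad A B)).
Hypothesis hA : A = A^t*.
Hypothesis hg : `|a| ^+ 2 - `|b| ^+ 2 = 1.
Hypothesis detQ : \det (ratquad A B) != 0.
Hypothesis simple_poles : forall c, is_pole F c -> pole_of_order F c 1.
Hypothesis alpha_inj : injective alpha.
Hypothesis polesE : forall c, is_pole F c <-> exists j, alpha j = c.
Hypothesis residues : forall j, is_residue F (alpha j) (P j).
Hypothesis residue0_unit : \det B != 0 -> P0 = 0.
Hypothesis residue0 : \det B = 0 -> is_residue F 0 P0.

Lemma reg_off_poles c : (forall j, alpha j <> c) -> forall i k, reg c (F i k).
Proof.
by move=> nc; apply: contrapT => /polesE[j jc]; exact: nc jc.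
Qed.

Lemma reg_residues j i k :
  reg (alpha j) (F i k - ratC (P j i k) / (X - ratC (alpha j))).
Proof.
apply: (simple_pole_residue _ (residues j)).
by apply: simple_poles; apply/polesE; exists j.
Qed.

(** At 0 the pencil is the adjoint of B: either det B is nonzero, [F] is regular and [P0] is 0, or 0
    is a pole, simple by assumption, with residue [P0]. *)
Lemma reg_residue0 i k : reg 0 (F i k - ratC (P0 i k) / X).
Proof.
have [dB|dB] := eqVneq (\det B) 0; last first.
  rewrite residue0_unit // mxE rmorph0 mul0r subr0.
  exact: reg0_invmx.
have := simple_pole_residue (simple_poles (pole0 detQ dB)) (residue0 dB) i k.
by rewrite polyC0 tofrac0 subr0.
Qed.

Let gQ := quadmx X
  (- ((ratC a^* * ratC b^*) *: map_mx ratC A) + ratC a^* ^+ 2 *: map_mx ratC B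
     + ratC b^* ^+ 2 *: map_mx ratC (B^t* ))
  ((ratC a * ratC a^* + ratC b * ratC b^*) *: map_mx ratC A
     - 2 *: ((ratC a^* * ratC b) *: map_mx ratC B
             + (ratC a * ratC b^*) *: map_mx ratC (B^t* )))
  (- ((ratC a * ratC b) *: map_mx ratC A) + ratC a ^+ 2 *: map_mx ratC (B^t* )
     + ratC b ^+ 2 *: map_mx ratC B).

Lemma ratquad_gAB : ratquad (gA a b A B) (gB a b A B) = gQ.
Proof.
rewrite /ratquad (gB_adj a b B hA) gBE gAE.
have [e1 e2 e3] := map_gAB ratC a b a^* b^* A B (B^t* ).
by rewrite /gQ -e1 -e2 -e3.
Qed.

Lemma ratrhs_gAB : ratrhs mu (gA a b A B) (gB a b A B) D = rhsmx mu X
  (- ((ratC a^* * ratC b^*) *: map_mx ratC A) + ratC a^* ^+ 2 *: map_mx ratC B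
     + ratC b^* ^+ 2 *: map_mx ratC (B^t* ))
  ((ratC a * ratC a^* + ratC b * ratC b^*) *: map_mx ratC A
     - 2 *: ((ratC a^* * ratC b) *: map_mx ratC B
             + (ratC a * ratC b^*) *: map_mx ratC (B^t* )))
  (map_mx ratC D).
Proof.
rewrite /ratrhs gBE gAE.
have [e1 e2 _] := map_gAB ratC a b a^* b^* A B (B^t* ).
by rewrite -e1 -e2.
Qed.

Lemma moved_pole_neq0 j : (ratC a^* * X + - ratC b) / (- ratC b^* * X + ratC a)
   - ratC (alpha j) != 0.
Proof.
exact: (mobius_sub_neq0 (cden_frac_neq0 hg) (numer_neq0 hg (alpha j))).
Qed.

Lemma moved_simple_frac j : (- ratC b^* * X + ratC a) ^- 2
   / ((ratC a^* * X + - ratC b) / (- ratC b^* * X + ratC a) - ratC (alpha j))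
  = simple_frac (mobius a b (Some (alpha j))) - simple_frac (mobius a b None).
Proof.
exact: (mobius_simple_frac (ratC_det hg) (cden_frac_neq0 hg)
  (numer_neq0 hg (alpha j)) (simple_frac_mobius a b (alpha j))
  (simple_frac_mobius_oo a b)).
Qed.

Lemma moved_det_neq0 : \det (ratquad (gA a b A B) (gB a b A B)) != 0.
Proof.
rewrite -unitfE -unitmxE ratquad_gAB.
exact: (mobius_quad_unit hA detQ alpha_inj reg_off_poles reg_residues
  reg_residue0 (cden_frac_neq0 hg) moved_pole_neq0).
Qed.

Lemma moved_resolvent :
  invmx (ratquad (gA a b A B) (gB a b A B))
    *m ratrhs mu (gA a b A B) (gB a b A B) D
  = \sum_(j < N | mobius a b (Some (alpha j)) != None)
      simple_frac (mobius a b (Some (alpha j)))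
        *: ratmx (P j *m (- (mu%:R *: (alpha j *: B + 2^-1 *: A)) + D))
    - simple_frac (mobius a b None)
        *: ratmx (P0^t* *m ((mu%:R / 2) *: A + D)).
Proof.
rewrite ratquad_gAB ratrhs_gAB.
apply: etrans (mobius_resolvent hA detQ alpha_inj reg_off_poles reg_residues
  reg_residue0 D mu (su11_det hg) (cden_frac_neq0 hg) moved_pole_neq0
  moved_simple_frac (simple_frac_mobius_oo a b)) _.
(* The indices with g.alpha_j infinite may be restored, since [simple_frac] is 0 there. *)
congr (_ - _); rewrite [RHS]big_mkcond; apply: eq_bigr => j _.
by case: eqP => [->|//]; rewrite scale0r.
Qed.
End RationalIdentity.

Theorem mainTheorem3 (R : realType) (p mu : nat) (hp : (1 <= p)%N)
    (hmu : (1 <= mu)%N) (A B C : 'M[Cplx R]_p) (hA : A = A^t*) (hC : C = C^t*)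
    (a b : Cplx R) (hg : `|a| ^+ 2 - `|b| ^+ 2 = 1) :
  (forall f : Cplx R -> 'cV[Cplx R]_p, Hmu_vec mu f ->
     (solves mu A B C f <->
      solves mu (gA a b A B) (gB a b A B) C (tau mu (su11 a b) f))) /\
  (\det (ratquad A B) != 0 ->
   (forall c, is_pole (invmx (ratquad A B)) c ->
      pole_of_order (invmx (ratquad A B)) c 1) ->
   forall (N : nat) (alpha : 'I_N -> Cplx R) (P : 'I_N -> 'M[Cplx R]_p)
     (P0 : 'M[Cplx R]_p),
   injective alpha ->
   (forall c, is_pole (invmx (ratquad A B)) c <-> exists j, alpha j = c) ->
   (forall j, is_residue (invmx (ratquad A B)) (alpha j) (P j)) ->
   (\det B != 0 -> P0 = 0) ->
   (\det B = 0 -> is_residue (invmx (ratquad A B)) 0 P0) ->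
   [/\ \det B = 0 -> is_pole (invmx (ratquad A B)) 0,
       \det (ratquad (gA a b A B) (gB a b A B)) != 0 &
       invmx (ratquad (gA a b A B) (gB a b A B))
         *m ratrhs mu (gA a b A B) (gB a b A B) C
       = \sum_(j < N | mobius a b (Some (alpha j)) != None)
           simple_frac (mobius a b (Some (alpha j)))
             *: ratmx (P j *m (- (mu%:R *: (alpha j *: B + 2^-1 *: A)) + C))
         - simple_frac (mobius a b None)
             *: ratmx (P0^t* *m ((mu%:R / 2) *: A + C))]).
Proof.
split=> [f fH|detQ simple N alpha P P0 alpha_inj polesE res res_unit res0].
  exact: solves_tau.
split; first exact: pole0.
  exact: (moved_det_neq0 hA hg detQ simple alpha_inj polesE res res_unit res0).
exact: (moved_resolvent mu C hA hg detQ simple alpha_inj polesE res res_unit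
  res0).
Qed.
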